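(* Let $\mathcal A=\{0=a_0<a_1<\cdots\}\subseteq\mathbb N$ be a finite or infinite set containing $0$. For $n\ge0$ let $f(n)$ be the number of ways to write $n=\sum_{k\ge0}\epsilon_k2^k$ with all $\epsilon_k\in\mathcal A$, and set $f(n)=0$ for $n<0$. Then for every integer $n\neq0$, $$\Theta(n):=\sum_{k}f(n-a_k)\equiv0\pmod 2.$$
   Context: Representations are counted as sequences $(\epsilon_k)_{k\ge0}$ in $\mathcal A$ with finitely many nonzero terms. The sum defining $\Theta(n)$ is finite because $f(n-a_k)=0$ whenever $a_k>n$. *)

(* Defs.v *)
From HB Require Import structures.
From mathcomp Require Import all_boot all_order all_algebra.
From mathcomp Require Import finmap.
From mathcomp Require Import boolp classical_sets functions cardinality fsbigop.
From mathcomp Require Import zify.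

Set Implicit Arguments.
Unset Strict Implicit.
Unset Printing Implicit Defensive.

Local Open Scope classical_set_scope.

Definition binary_value (eps : {fsfun nat -> nat with 0%N}) : nat :=
  \sum_(k <- finsupp eps) eps k * 2 ^ k.

Definition representations (A : set nat) (n : nat)
    : set {fsfun nat -> nat with 0%N} :=
  [set eps : {fsfun nat -> nat with 0%N} | (forall k, A (eps k)) /\ n = binary_value eps].

(* [fset_set] is the empty set on infinite sets, hence this lemma. *)
Lemma finite_representations (A : set nat) (n : nat) :
  finite_set (representations A n).
Proof.
pose dig (g : {ffun 'I_n.+1 -> 'I_n.+1}) : {fsfun nat -> nat with 0%N} :=
  [fsfun k in [fset k | k in iota 0 n.+1]%fset => val (g (inord k))].
apply: (@sub_finite_set _ _ (dig @` setT)); last first.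
  exact/finite_image/finite_finset.
move=> eps [_ nE].
have term k : k \in finsupp eps -> eps k * 2 ^ k <= n.
  by move=> ks; rewrite nE /binary_value (big_fsetD1 k) //= leq_addr.
have le_n k : eps k <= n.
  have [ks|/fsfun_dflt-> //] := boolP (k \in finsupp eps).
  by apply: leq_trans (term k ks); rewrite leq_pmulr // expn_gt0.
have supp_n k : k \in finsupp eps -> k < n.+1.
  move=> ks; rewrite ltnS; apply: leq_trans (term k ks).
  rewrite (leq_trans (ltnW (ltn_expl k (ltnSn 1)))) // leq_pmull //.
  by rewrite lt0n -mem_finsupp.
exists [ffun i : 'I_n.+1 => inord (eps i)] => //.
apply/fsfunP => k; rewrite /dig fsfunE.
have -> : (k \in [fset k | k in iota 0 n.+1]%fset) = (k < n.+1).
  by rewrite !inE -[_ || _]/(k \in iota 0 n.+1) mem_iota.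
case: ifPn => kn; first by rewrite ffunE /= !inordK // ltnS.
by apply/esym/fsfun_dflt; apply: contra kn; apply: supp_n.
Qed.

Definition num_representations (A : set nat) (z : int) : nat :=
  match z with
  | Posz n => #|` fset_set (representations A n)|%fset
  | Negz _ => 0
  end.

Definition Theta (A : set nat) (n : int) : nat :=
  \big[addn/0]_(a \in A) num_representations A (n - a%:Z)%R.

(* Sums over an infinite support are zero by convention, hence this lemma. *)
Lemma finite_Theta_support (A : set nat) (n : int) :
  finite_set
    (A `&` (fun a : nat => num_representations A (n - a%:Z)%R) @^-1` [set~ 0]).
Proof.
apply: (@sub_finite_set _ _ `I_(`|n|.+1)); last exact: finite_II.
move=> a [_ /=]; case E: (n - a%:Z)%R => [m|m] //= _.
by lia.
Qed.

(* Main.v *)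
Require Import Defs.
From mathcomp Require Import all_boot all_order all_algebra.
From mathcomp Require Import boolp classical_sets.
From mathcomp Require Import finmap functions cardinality fsbigop zify.

(** Summing over the lowest digit gives f(m) = sum_b h(m - b), where b ranges
    over A and h(z) is f(z/2) for even z and 0 for odd z.  Hence
    Theta(n) = sum_(a, b) h(n - a - b), and cancelling the pairs (a, b), (b, a)
    modulo 2 leaves the diagonal sum_a h(n - 2a), which is Theta(n/2) for even n
    and 0 for odd n.  This is the power series identity phi F = phi^2 F(x^2)
    modulo 2, and descent on n concludes. *)

(** Indexing by an initial segment instead of the support makes a shift of the digits a mere
    reindexing. *)
Lemma binary_value_bounded (eps : {fsfun nat -> nat with 0}) (N : nat) :
  (forall k, N <= k -> eps k = 0) ->
  binary_value eps = \sum_(k < N) eps k * 2 ^ k.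
Proof.
move=> epsN; rewrite /binary_value -(big_mkord xpredT (fun k => eps k * 2 ^ k)).
have -> : \sum_(0 <= k < N) eps k * 2 ^ k
    = \sum_(k <- [fset k | k in iota 0 N]%fset) eps k * 2 ^ k.
  by rewrite big_imfset //= /index_iota subn0 undup_id ?iota_uniq.
apply: big_fset_incl => [|k _ /fsfun_dflt -> //].
apply/fsubsetP => k; rewrite mem_finsupp => /eqP epsk.
rewrite !inE /= mem_iota add0n /=.
by case: ltnP => // /epsN.
Qed.

Lemma fsfun_eventually0 (eps : {fsfun nat -> nat with 0}) :
  exists N, forall k, N <= k -> eps k = 0.
Proof.
exists (\max_(k <- finsupp eps) k).+1 => k kN; apply: fsfun_dflt.
by apply/negP => ks; move: kN; rewrite ltnNge (@leq_bigmax_seq _ _ xpredT id).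
Qed.

Definition digits_cons (b : nat) (eps : {fsfun nat -> nat with 0}) :
    {fsfun nat -> nat with 0} :=
  [fsfun k in (0 |` [fset j.+1 | j in finsupp eps])%fset =>
     if k is j.+1 then eps j else b].

Lemma digits_cons0 b eps : digits_cons b eps 0 = b.
Proof. by rewrite fsfunE !inE. Qed.

Lemma digits_consS b eps k : digits_cons b eps k.+1 = eps k.
Proof.
rewrite fsfunE; case: ifPn => //; rewrite !inE /= => H; apply/esym/fsfun_dflt.
by apply: contra H => ks; apply/imfsetP; exists k.
Qed.

(** Since [0.-1 = 0], the index set may contain 0 outside the new support; this is harmless, as the
    value there is still [eps 1]. *)
Definition digits_behead (eps : {fsfun nat -> nat with 0}) :
    {fsfun nat -> nat with 0} :=
  [fsfun k in [fset j.-1 | j in finsupp eps]%fset => eps k.+1].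

Lemma digits_beheadE eps k : digits_behead eps k = eps k.+1.
Proof.
rewrite fsfunE; case: ifPn => // H; apply/esym/fsfun_dflt.
by apply: contra H => ks; apply/imfsetP; exists k.+1.
Qed.

Lemma digits_consK (eps : {fsfun nat -> nat with 0}) :
  digits_cons (eps 0) (digits_behead eps) = eps.
Proof.
by apply/fsfunP => -[|k]; rewrite ?digits_cons0 // digits_consS digits_beheadE.
Qed.

Lemma digits_cons_inj b : injective (digits_cons b).
Proof.
move=> e1 e2 E; apply/fsfunP => k.
by rewrite -(digits_consS b e1) E digits_consS.
Qed.

Lemma binary_value_cons b eps :
  binary_value (digits_cons b eps) = b + (binary_value eps).*2.
Proof.
have [N epsN] := fsfun_eventually0 eps.
rewrite (@binary_value_bounded eps N) // (@binary_value_bounded _ N.+1); last first.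
  by case=> // k Nk; rewrite digits_consS epsN.
rewrite big_ord_recl digits_cons0 muln1 -mul2n big_distrr /=; congr (_ + _).
by apply: eq_bigr => i _; rewrite digits_consS expnS mulnCA.
Qed.

Lemma representations_cons (A : set nat) (n b : nat) eps :
  representations A n (digits_cons b eps) <->
  A b /\ exists2 m, n = b + m.*2 & representations A m eps.
Proof.
rewrite /representations /= binary_value_cons; split.
  move=> [Aeps ->]; split; first by have := Aeps 0; rewrite digits_cons0.
  exists (binary_value eps) => //; split=> // k.
  by have := Aeps k.+1; rewrite digits_consS.
move=> [Ab [_ -> [Aeps ->]]]; split=> // -[|k].
  by rewrite digits_cons0.
by rewrite digits_consS.
Qed.

(** The coefficient of [x^z] in [F(x^2)], where [F] is the generating series of [f]. *)
Definition num_representations_half (A : set nat) (z : int) : nat :=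
  if z is Posz m then if odd m then 0 else num_representations A m./2 else 0.

(** [digits_cons b] is a bijection from the representations of [(n - b)/2] onto those of [n] with
    lowest digit [b]. *)
Lemma card_representations_digit0 (A : set nat) (n b : nat) : A b ->
  count (fun eps : {fsfun nat -> nat with 0} => eps 0 == b)
    (fset_set (representations A n))
  = num_representations_half A (n%:Z - b%:Z)%R.
Proof.
move=> Ab; rewrite -size_filter.
have memR m := in_fset_set (finite_representations A m).
have memF eps : (eps \in [seq eps : {fsfun nat -> nat with 0} <-
    fset_set (representations A n) | eps 0 == b])
    = (eps 0 == b) && (eps \in representations A n).
  by rewrite mem_filter memR.
case: (boolP ((b <= n) && ~~ odd (n - b))) => [/andP[bn Enb]|nbn].
  have -> : (n%:Z - b%:Z)%R = Posz (n - b) by lia.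
  rewrite /= (negbTE Enb) /num_representations -[RHS](size_map (digits_cons b)).
  apply/perm_size/uniq_perm; rewrite ?filter_uniq ?fset_uniq //.
    by rewrite (map_inj_uniq (@digits_cons_inj b)) fset_uniq.
  move=> eps; rewrite memF; apply/andP/mapP => [[/eqP e0 /set_mem]|].
    rewrite -{1}(digits_consK eps) e0 => /representations_cons[_ [m nE Rm]].
    exists (digits_behead eps); last by rewrite -e0 digits_consK.
    rewrite memR; apply/mem_set; suff -> : (n - b)./2 = m by [].
    by lia.
  move=> [e]; rewrite memR => /set_mem Re ->; rewrite digits_cons0; split=> //.
  apply/mem_set/representations_cons; split=> //.
  by exists (n - b)./2 => //; lia.
(* Here [b > n] or [n - b] is odd, so both sides vanish: a representation with lowest digit [b]
   would give [n = b + m.*2]. *)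
have -> : num_representations_half A (n%:Z - b%:Z)%R = 0.
  rewrite /num_representations_half; case E: (n%:Z - b%:Z)%R => [m|//].
  by case: ifPn => // om; move: nbn; lia.
apply/eqP; rewrite size_eq0 -[_ == _]negbK; apply/negP => /eqP.
case E : [seq _ <- _ | _] => [//|eps s] _.
have := memF eps; rewrite E mem_head => /esym/andP[/eqP e0 /set_mem].
rewrite -(digits_consK eps) e0 => /representations_cons[_ [m nE _]].
by move: nbn; lia.
Qed.

Lemma representations_digit0_le (A : set nat) (n : nat) (eps : {fsfun nat -> nat with 0}) :
  representations A n eps -> eps 0 <= n.
Proof.
by rewrite -{1}(digits_consK eps) => /representations_cons[_ [m -> _]]; lia.
Qed.

(** The bound [N] is left free so that different values of [z] can share one range of digits. *)
Lemma num_representations_rec (A : set nat) (z : int) (N : nat) : (z < N%:Z)%R ->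
  num_representations A z
  = \sum_(b < N | (b : nat) \in A) num_representations_half A (z - b%:Z)%R.
Proof.
case: z => [n|n] zN; last by rewrite big1 // => b _; case E: (_ - _)%R => //; lia.
rewrite /num_representations card_fset_sum1 big_seq.
(* Each representation is counted once, at its own lowest digit; exchanging the sums then groups
   them by that digit. *)
transitivity (\sum_(eps <- fset_set (representations A n))
    \sum_(b < N | (b : nat) \in A) (eps 0 == b : nat)).
  rewrite [RHS]big_seq; apply: eq_bigr => eps.
  rewrite in_fset_set; last exact: finite_representations.
  move=> /set_mem Reps.
  have eN : eps 0 < N by apply: leq_ltn_trans (representations_digit0_le _ _ _ Reps) _.
  rewrite (bigD1 (Ordinal eN)) /=; last by apply/mem_set; case: Reps.
  rewrite eqxx big1 // => i /andP[_ /eqP iN].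
  by apply/eqP; rewrite eqb0; apply/eqP => e0; apply: iN; apply: val_inj.
rewrite exchange_big; apply: eq_bigr => b /set_mem Ab /=.
by rewrite -card_representations_digit0 // -sum1_count [RHS]big_mkcond.
Qed.

Lemma ThetaE (A : set nat) (n N : nat) : n < N ->
  Theta A n = \sum_(a < N | (a : nat) \in A) num_representations A (n%:Z - a%:Z)%R.
Proof.
move=> nN; rewrite /Theta fsbig_mkcond.
rewrite -(fsbig_widen (`I_N)%classic) //; last first.
  move=> a [_ /= aN]; rewrite patchE; case: ifP => // _.
  by case E: (_ - _)%R => //; lia.
by rewrite -fsbig_ord [RHS]big_mkcond; apply: eq_bigr => a _; rewrite patchE.
Qed.

(** By induction on the size of the square: a new index adds a row, an equal column and one diagonal
    entry. *)
Lemma odd_sum_symmetric (P : pred nat) (g : nat -> nat -> nat) (N : nat) :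
  (forall a b, g a b = g b a) ->
  odd (\sum_(a < N | P a) \sum_(b < N | P b) g a b)
  = odd (\sum_(a < N | P a) g a a).
Proof.
move=> gC; elim: N => [|N IH]; first by rewrite !big_ord0.
(* With the condition moved into the summand, the last index can be split off whether or not it
   satisfies [P]. *)
rewrite !(big_mkcond (fun a : 'I_N.+1 => P a)) !big_ord_recr /=.
rewrite -!(big_mkcond (fun a : 'I_N => P a)) /=.
case: ifP => PN.
  rewrite (eq_bigr (fun a : 'I_N => \sum_(b < N | P b) g a b + g a N)); last first.
    move=> i _; rewrite big_mkcond big_ord_recr /= PN -big_mkcond //.
  rewrite big_split /= big_mkcond [X in _ + X]big_mkcond /= big_ord_recr /= PN.
  rewrite -!big_mkcond /= (eq_bigr (fun a : 'I_N => g N a) (fun a _ => gC a N)).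
  by rewrite !oddD IH; do 3 case: odd.
rewrite !addn0 (eq_bigr (fun a : 'I_N => \sum_(b < N | P b) g a b)) // => i _.
by rewrite big_mkcond big_ord_recr /= PN addn0 -big_mkcond.
Qed.

Lemma odd_Theta (A : set nat) (n : nat) :
  odd (Theta A n) = if odd n then false else odd (Theta A n./2).
Proof.
rewrite (@ThetaE A n n.+1) //.
pose g a b := num_representations_half A (n%:Z - a%:Z - b%:Z)%R.
(* As [n - a < n.+1] for every [a], one bound serves both indices and the double sum is square. *)
rewrite (eq_bigr (fun a : 'I_n.+1 => \sum_(b < n.+1 | (b : nat) \in A) g a b));
  last by move=> a _; rewrite -num_representations_rec //; lia.
rewrite (@odd_sum_symmetric (fun a => a \in A) g); last first.
  by move=> a b; rewrite /g; congr num_representations_half; lia.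
(* The difference [n - 2a] has the parity of [n], and its half is [n/2 - a] when [n] is even. *)
have gE a : g a a = if odd n then 0 else num_representations A (n./2%:Z - a%:Z)%R.
  rewrite /g /num_representations_half.
  case E: (n%:Z - a%:Z - a%:Z)%R => [m|m].
    have -> : odd m = odd n by lia.
    by case: ifP => // on; congr num_representations; lia.
  by case: ifP => // on; case E': (_ - _)%R => //; lia.
under eq_bigr => a _ do rewrite gE.
case: ifP => on; first by rewrite big1.
by rewrite (@ThetaE A n./2 n.+1) //; lia.
Qed.

Theorem theorem3p1 (A : set nat) (hA : A 0) (n : int) (hn : n <> 0%R) :
  Theta A n = 0 %[mod 2].
Proof.
case: n hn => [n|n] hn; last first.
  rewrite /Theta fsbig1 // => a _; case E: (_ - _)%R => //; lia.
rewrite !modn2; congr nat_of_bool.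
(* For even nonzero [n], [n./2] is smaller and still nonzero, so the descent ends at an odd
   number. *)
elim/ltn_ind: n hn => n IH hn; rewrite odd_Theta; case: ifP => // on.
by apply: IH; lia.
Qed.
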